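(* The relation $\sqsubseteq$ is a preorder on the class $\mathscr{G}$ of all MW-graphs, i.e. it is reflexive and transitive. Moreover, for finite MW-graphs, $\sqsubseteq$ is a partial order on the equivalence classes of MW-isomorphic graphs in the class of MW-graphs with standard weights and in the class of MW-graphs with combinatorial weights (or on any subclass of MW-graphs all of whose edge weights equal a common constant).
   Context: Graphs: a graph $G=(V,E,\partial)$ consists of disjoint, at most countable sets $V$ (vertices) and $E$ (edges), a map $\partial\colon E\to V\times V$, $\partial e=(\partial_-e,\partial_+e)$, and an involution $e\mapsto\bar e$ on $E$ with $e\neq\bar e$ and $\partial_\pm\bar e=\partial_\mp e$. Loops and multiple edges are allowed; $\deg(v)=|\{e\in E:\partial_-e=v\}|<\infty$ for all $v$. A weight $w$ on $G$ consists of $w\colon V\to(0,\infty)$ and $w\colon E\to(0,\infty)$ with $w_{\bar e}=w_e$ and $\sup_v\frac1{w(v)}\sum_{\partial_-e=v}w_e<\infty$. A magnetic potential is $\alpha\colon E\to R$ with $\alpha_{\bar e}=-\alpha_e$, $R$ a fixed subgroup of $\mathbb{R}/2\pi\mathbb{Z}$. An MW-graph is $\mathbf{G}=(G,\alpha,w)$; finite means $V$ finite. Standard weights: $w(v)=\deg(v)$, $w_e=1$. Combinatorial weights: $w(v)=1$, $w_e=1$. A graph homomorphism $\pi\colon G\to G'$ consists of maps $\pi\colon V\to V'$, $\pi\colon E\to E'$ with $\pi(\partial_\pm e)=\partial'_\pm(\pi e)$. An MW-homomorphism $\pi\colon\mathbf{G}\to\mathbf{G}'$ is a graph homomorphism with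 $\alpha_e=\alpha'_{\pi e}$ for all $e\in E$, $\sum_{v\in V,\pi(v)=v'}w(v)\ge w'(v')$ for all $v'\in V'$, and $\sum_{e\in E,\pi(e)=e'}w_e\le w'_{e'}$ for all $e'\in E'$. An MW-isomorphism is a bijective (on vertices and on edges) $\pi$ such that $\pi$ and $\pi^{-1}$ are both MW-homomorphisms. $\mathbf{G}\sqsubseteq\mathbf{G}'$ means that there exists an MW-homomorphism $\mathbf{G}\to\mathbf{G}'$. *)

(* Defs.v *)
From HB Require Import structures.
From mathcomp Require Import all_boot all_order all_algebra.
From mathcomp Require Import finmap.
From mathcomp Require Import all_classical all_reals all_analysis.
From Stdlib Require Export Relation_Definitions.

Set Implicit Arguments.
Unset Strict Implicit.
Unset Printing Implicit Defensive.

Import Order.TTheory GRing.Theory Num.Theory.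

Local Open Scope classical_set_scope.
Local Open Scope ring_scope.

Definition two_pi_Z (R : realType) : {pred R} :=
  fun x => `[< exists k : int, x = k%:~R * (2 * pi) >].
Arguments two_pi_Z : clear implicits.

Fact two_pi_Z_zmod_closed (R : realType) : zmod_closed (two_pi_Z R).
Proof.
split=> [|x y]; first by apply/asboolP; exists 0; rewrite mul0r.
move=> /asboolP[k ->] /asboolP[l ->]; apply/asboolP; exists (k - l).
by rewrite intrB mulrBl.
Qed.

HB.instance Definition _ (R : realType) :=
  GRing.isZmodClosed.Build R (two_pi_Z R) (two_pi_Z_zmod_closed R).

(* The additive group R / 2 pi Z. *)
Definition angle (R : realType) : zmodType := Quotient.quot (two_pi_Z R).

(* [bd e] is the pair (initial vertex, terminal vertex); [bar] reverses an
   edge, so every undirected edge (loops included) is a pair {e, bar e}. *)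
Record graph := Graph {
  vertex : countType;
  edge : countType;
  bd : edge -> vertex * vertex;
  bar : edge -> edge;
  bar_involutive : involutive bar;
  bar_neq : forall e, bar e <> e;
  bd_bar : forall e, bd (bar e) = ((bd e).2, (bd e).1);
  finite_star : forall v, finite_set [set e | (bd e).1 = v]
}.

Definition star (G : graph) (v : vertex G) : set (edge G) :=
  [set e | (bd e).1 = v].

Definition deg (G : graph) (v : vertex G) : nat := #|` fset_set (star v)|.

Record weight (R : realType) (G : graph) := Weight {
  vweight : vertex G -> R;
  eweight : edge G -> R;
  vweight_gt0 : forall v, 0 < vweight v;
  eweight_gt0 : forall e, 0 < eweight e;
  eweight_bar : forall e, eweight (bar e) = eweight e;
  rel_weight_bounded :
    (ereal_sup (range (fun v =>
       (vweight v)^-1%:E * \esum_(e in star v) (eweight e)%:E)) < +oo)%E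
}.

(* [A] is the fixed subgroup of R / 2 pi Z in which potentials take values. *)
Record magnetic_potential (R : realType) (A : zmodClosed (angle R))
    (G : graph) := MagneticPotential {
  potential : edge G -> angle R;
  potential_in : forall e, potential e \in A;
  potential_bar : forall e, potential (bar e) = - potential e
}.

Record mwgraph (R : realType) (A : zmodClosed (angle R)) := MWGraph {
  mw_graph :> graph;
  mw_potential : magnetic_potential A mw_graph;
  mw_weight : weight R mw_graph
}.

Section MWGraphs.
Context {R : realType} {A : zmodClosed (angle R)}.
Implicit Types G H : mwgraph A.

Definition alpha G (e : edge G) : angle R := potential (mw_potential G) e.
Definition wV G (v : vertex G) : R := vweight (mw_weight G) v.
Definition wE G (e : edge G) : R := eweight (mw_weight G) e.

Definition graph_hom (G H : graph)
    (f : vertex G -> vertex H) (g : edge G -> edge H) : Prop :=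
  forall e, bd (g e) = (f (bd e).1, f (bd e).2).

(* A fibre may be infinite, so the sums are taken in the extended reals. *)
Definition mw_hom G H
    (f : vertex G -> vertex H) (g : edge G -> edge H) : Prop :=
  [/\ graph_hom f g,
      forall e, alpha e = alpha (g e),
      forall v', ((wV v')%:E <= \esum_(v in [set v | f v = v']) (wV v)%:E)%E
    & forall e', (\esum_(e in [set e | g e = e']) (wE e)%:E <= (wE e')%:E)%E].

Definition mw_iso G H : Prop :=
  exists f : vertex G -> vertex H, exists g : edge G -> edge H,
  exists f' : vertex H -> vertex G, exists g' : edge H -> edge G,
  [/\ cancel f f' /\ cancel f' f, cancel g g' /\ cancel g' g,
      mw_hom f g & mw_hom f' g'].

Definition mw_le G H : Prop :=
  exists f : vertex G -> vertex H, exists g : edge G -> edge H, mw_hom f g.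

Definition mw_finite G : Prop := finite_set [set: vertex G].

Definition standard_weights G : Prop :=
  (forall v : vertex G, wV v = (deg v)%:R) /\ (forall e : edge G, wE e = 1).

Definition combinatorial_weights G : Prop :=
  (forall v : vertex G, wV v = 1) /\ (forall e : edge G, wE e = 1).

Implicit Type C : mwgraph A -> Prop.

Definition is_isoclass C (X : mwgraph A -> Prop) : Prop :=
  exists2 G, C G & X = (fun H => C H /\ mw_iso G H).

Definition isoclass C : Type := {X : mwgraph A -> Prop | is_isoclass C X}.

Definition isoclass_le C (X Y : isoclass C) : Prop :=
  exists G H, [/\ sval X G, sval Y H & mw_le G H].

(* Before the order itself: the quotient and the relation on it are well defined:
   MW-isomorphism is an equivalence relation, and [isoclass_le] can be tested
   on arbitrary representatives. *)
Definition mw_le_order_on_isoclasses C : Prop :=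
  [/\ equivalence (mwgraph A) mw_iso,
      forall (X Y : isoclass C) G H, sval X G -> sval Y H ->
        (isoclass_le X Y <-> mw_le G H)
    & order (isoclass C) (@isoclass_le C)].

End MWGraphs.

(* Main.v *)
Require Import Defs.
From mathcomp Require Import all_boot all_order all_algebra.
From mathcomp Require Import all_classical all_reals all_analysis.

(** Transitivity is a double summation: the fibre of a composite over [z] is
    the disjoint union of the fibres over the points of the fibre of [z], so
    sums of nonnegative weights along fibres can be taken in two steps
    ([esum_fibre_comp]), and both weight inequalities survive composition.

    Antisymmetry is the substantial part.  Let [G] and [H] be finite with all
    edge weights equal to [c], and let homomorphisms go both ways.  Vertex
    weights are positive, so no vertex fibre is empty: a homomorphism is
    surjective on vertices.  Two edges in one fibre would weigh [2 * c > c]: it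
    is injective on edges.  Composing the two homomorphisms gives surjective
    self-maps of finite vertex sets and injective self-maps of finite edge sets
    (local finiteness makes these finite); hence all the maps are bijections.
    Along a vertex bijection weights can only decrease, and around the loop
    [G -> H -> G] they are permuted, so their sum is preserved; hence no weight
    changes at all ([finite_self_map_nonincreasing]) and the inverse bijections
    form a homomorphism ([mw_le_antisym]).

    Any preorder that is antisymmetric up to MW-isomorphism induces an order on
    isomorphism classes ([mw_le_order_on_isoclasses_of_antisym]); standard and
    combinatorial weights both have [c = 1]. *)

Set Implicit Arguments.
Unset Strict Implicit.
Unset Printing Implicit Defensive.

Import Order.TTheory GRing.Theory Num.Theory.

Local Open Scope classical_set_scope.
Local Open Scope ring_scope.

(** * Self-maps of finite types *)

Section FiniteSelfMaps.
Context {T : choiceType} (p : T -> T).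
Hypothesis finT : finite_set [set: T].

Lemma finite_enumeration : exists2 s : seq T, uniq s & forall x, x \in s.
Proof.
have /finite_seqP[s sT] := finT; exists (undup s); first exact: undup_uniq.
by move=> x; rewrite mem_undup; have : [set: T] x by []; rewrite sT.
Qed.

Lemma finite_surj_inj : (forall y, exists x, p x = y) -> injective p.
Proof.
move=> surj_p; have [s us sT] := finite_enumeration.
have ups : uniq (map p s).
  apply: (leq_size_uniq us); last by rewrite size_map.
  by move=> y _; have [x <-] := surj_p y; rewrite map_f.
move=> x y pxy.
rewrite -(nth_index x (sT x)) -(nth_index x (sT y)); congr (nth _ _ _).
have szx : (index x s < size (map p s))%N by rewrite size_map index_mem.
have szy : (index y s < size (map p s))%N by rewrite size_map index_mem.
apply/eqP; rewrite -(nth_uniq (p x) szx szy ups).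
by rewrite !(nth_map x) ?index_mem// !nth_index// pxy.
Qed.

Hypothesis injp : injective p.

Lemma finite_inj_map_perm (s : seq T) :
  uniq s -> (forall x, x \in s) -> perm_eq (map p s) s.
Proof.
move=> us sT; have ups : uniq (map p s) by rewrite map_inj_uniq.
apply: uniq_perm => //.
by have [|_] := uniq_min_size ups (fun x _ => sT x); rewrite ?size_map.
Qed.

Lemma finite_inj_surj y : exists x, p x = y.
Proof.
have [s us sT] := finite_enumeration.
have : y \in map p s by rewrite (perm_mem (finite_inj_map_perm us sT)).
by case/mapP => x _ ->; exists x.
Qed.

(** The defects [a x - a (p x)] are nonnegative, and their sum over the type
    vanishes because [p] permutes it. *)
Lemma finite_self_map_nonincreasing (R : numDomainType) (a : T -> R) :
  (forall x, a (p x) <= a x) -> forall x, a (p x) = a x.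
Proof.
move=> le_a x; have [s us sT] := finite_enumeration.
have : \sum_(y <- s) (a y - a (p y)) == 0.
  by rewrite sumrB -(perm_big _ (finite_inj_map_perm us sT)) big_map subrr.
rewrite psumr_eq0 => [|y _]; last by rewrite subr_ge0.
by move=> /allP/(_ x (sT x)); rewrite subr_eq0 => /eqP.
Qed.

End FiniteSelfMaps.

(** * Sums along fibres *)

Section FibreSums.
Context {R : realType} {T U V : choiceType}.
Implicit Types (f : T -> U) (g : U -> V) (a : T -> \bar R).

Lemma esum_fibre_comp f g a z : (forall x, 0 <= a x)%E ->
  (\esum_(x in [set x | g (f x) = z]) a x =
   \esum_(y in [set y | g y = z]) \esum_(x in [set x | f x = y]) a x)%E.
Proof.
move=> a0; rewrite (esum_esum (a := fun _ x => a x))//.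
(* Each [x] occurs in the double sum exactly once, as the pair [(f x, x)]. *)
rewrite (@reindex_esum _ _ _ [set x | g (f x) = z] _ (fun x => (f x, x)))//.
split=> [x //|x y _ _ []//|[y x] /= [gy fx]].
by exists x; rewrite fx.
Qed.

Lemma esum_fibre_inj f a x : injective f -> (0 <= a x)%E ->
  (\esum_(x' in [set x' | f x' = f x]) a x' = a x)%E.
Proof.
move=> injf ax; rewrite -[RHS](esum_set1 ax); congr esum.
by apply/seteqP; split=> [x' /= /injf|x' /= ->].
Qed.

Lemma esum_fibre_ge2 f a x y : (forall x, 0 <= a x)%E -> f x = f y -> x <> y ->
  (a x + a y <= \esum_(x' in [set x' | f x' = f y]) a x')%E.
Proof.
move=> a0 fxy xy; apply: esum_ge.
exists ([set x] `|` [set y]).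
  by split=> [|z [] ->//=]; rewrite finite_setU; split; exact: finite_set1.
rewrite fsbigU//=; first by rewrite !fsbig_set1.
by move=> z [/= ->] /xy.
Qed.

End FibreSums.

(** * The preorder of MW-homomorphisms *)

Section MWOrder.
Context {R : realType} {A : zmodClosed (angle R)}.
Implicit Types (G H K : mwgraph A) (C : mwgraph A -> Prop).

Lemma wV_gt0 G (v : vertex G) : 0 < wV v.
Proof. exact: vweight_gt0. Qed.

Lemma wE_gt0 G (e : edge G) : 0 < wE e.
Proof. exact: eweight_gt0. Qed.

Lemma wV_ge0 G (v : vertex G) : (0 <= (wV v)%:E)%E.
Proof. by rewrite lee_fin ltW// wV_gt0. Qed.

Lemma wE_ge0 G (e : edge G) : (0 <= (wE e)%:E)%E.
Proof. by rewrite lee_fin ltW// wE_gt0. Qed.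

Lemma mw_hom_id G : @mw_hom R A G G id id.
Proof.
split=> // [e|v|e]; first by case: (bd e).
- by rewrite (esum_fibre_inj (f := id))// wV_ge0.
- by rewrite (esum_fibre_inj (f := id))// wE_ge0.
Qed.

Lemma mw_hom_comp G H K (f1 : vertex G -> vertex H) (g1 : edge G -> edge H)
    (f2 : vertex H -> vertex K) (g2 : edge H -> edge K) :
  mw_hom f1 g1 -> mw_hom f2 g2 -> mw_hom (f2 \o f1) (g2 \o g1).
Proof.
move=> [bd1 al1 v1 e1] [bd2 al2 v2 e2]; split => [e|e|z|z] /=.
- by rewrite bd2 bd1.
- by rewrite al1 al2.
- rewrite esum_fibre_comp; last by move=> ?; exact: wV_ge0.
  by apply: (le_trans (v2 z)); apply: le_esum => y _; exact: v1.
- rewrite esum_fibre_comp; last by move=> ?; exact: wE_ge0.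
  by apply: le_trans (e2 z); apply: le_esum => y _; exact: e1.
Qed.

Lemma mw_le_preorder : preorder (mwgraph A) mw_le.
Proof.
split=> [G|G H K [f [g fg]] [f' [g' fg']]].
  by exists id, id; exact: mw_hom_id.
by exists (f' \o f), (g' \o g); exact: mw_hom_comp.
Qed.

Lemma mw_iso_equivalence : equivalence (mwgraph A) mw_iso.
Proof.
split=> [G|G H K|G H].
- by exists id, id, id, id; split=> //; exact: mw_hom_id.
- move=> [f1 [g1 [h1 [k1 [[fh1 hf1] [gk1 kg1] m1 n1]]]]].
  move=> [f2 [g2 [h2 [k2 [[fh2 hf2] [gk2 kg2] m2 n2]]]]].
  exists (f2 \o f1), (g2 \o g1), (h1 \o h2), (k1 \o k2); split.
  + by split; exact: can_comp.
  + by split; exact: can_comp.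
  + exact: mw_hom_comp.
  + exact: mw_hom_comp.
- move=> [f [g [f' [g' [[ff' f'f] [gg' g'g] fg fg']]]]].
  by exists f', g', f, g.
Qed.

Lemma mw_iso_le G H : mw_iso G H -> mw_le G H.
Proof. by move=> [f [g [_ [_ [_ _ fg _]]]]]; exists f, g. Qed.

(** * Homomorphisms between finite MW-graphs with constant edge weights *)

(** An empty fibre has weight [0], too little for a positive vertex weight. *)
Lemma mw_hom_vertex_surj G H (f : vertex G -> vertex H) (g : edge G -> edge H) :
  mw_hom f g -> forall v', exists v, f v = v'.
Proof.
move=> [_ _ le_v _] v'; apply: contrapT => nov.
have := le_v v'; rewrite [X in esum X _](_ : _ = set0).
  by rewrite esum_set0 lee_fin leNgt wV_gt0.
by apply/seteqP; split=> v //= fv; apply: nov; exists v.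
Qed.

Lemma mw_hom_vertex_le G H (f : vertex G -> vertex H) (g : edge G -> edge H) :
  mw_hom f g -> injective f -> forall v, wV (f v) <= wV v.
Proof.
move=> [_ _ le_v _] injf v; rewrite -lee_fin; apply: le_trans (le_v (f v)) _.
by rewrite (esum_fibre_inj (a := fun v => (wV v)%:E))// wV_ge0.
Qed.

(** Two edges in one fibre would weigh [c + c], more than the bound [c]. *)
Lemma mw_hom_edge_inj G H (c : R) (f : vertex G -> vertex H)
    (g : edge G -> edge H) :
  (forall e : edge G, wE e = c) -> (forall e : edge H, wE e = c) ->
  mw_hom f g -> injective g.
Proof.
move=> wG wH [_ _ _ le_e] x y gxy; apply: contrapT => xy.
have := le_e (g y); apply/negP; rewrite -ltNge.
apply: lt_le_trans (esum_fibre_ge2 _ gxy xy); last by move=> e; exact: wE_ge0.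
by rewrite -EFinD lte_fin wH !wG ltrDl -(wG x) wE_gt0.
Qed.

(** The composite is a surjective self-map of a finite set, hence injective,
    and so is its first factor. *)
Lemma mw_hom_vertex_inj G H (f : vertex G -> vertex H) (g : edge G -> edge H)
    (f' : vertex H -> vertex G) (g' : edge H -> edge G) :
  mw_finite G -> mw_hom f g -> mw_hom f' g' -> injective f.
Proof.
move=> finG fg fg'; apply: (@inj_compr _ _ _ f').
apply: finite_surj_inj => // v.
exact: mw_hom_vertex_surj (mw_hom_comp fg fg') v.
Qed.

Lemma mw_finite_edge G : mw_finite G -> finite_set [set: edge G].
Proof.
move=> finG; apply: sub_finite_set (_ : finite_set (\bigcup_v star v)).
  by move=> e _; exists (bd e).1.
by apply: bigcup_finite => // v _; exact: finite_star.
Qed.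

Lemma inj_surj_cancel (T U : choiceType) (f : T -> U) :
  injective f -> (forall y, exists x, f x = y) ->
  exists2 f', cancel f f' & cancel f' f.
Proof.
move=> injf surjf; have /choice[f' f'K] : forall y, exists x, f x = y by [].
by exists f' => // x; apply: injf; rewrite f'K.
Qed.

(** Once [f] and [g] are bijections, their inverses form a homomorphism as
    soon as [f] preserves vertex weights; it does because
    [wV (f' (f v)) <= wV (f v) <= wV v], where the outer terms are equal: the
    permutation [f' \o f] of a finite set cannot decrease any weight without
    increasing another. *)
Lemma mw_le_antisym G H (c : R) :
  mw_finite G -> mw_finite H ->
  (forall e : edge G, wE e = c) -> (forall e : edge H, wE e = c) ->
  mw_le G H -> mw_le H G -> mw_iso G H.
Proof.
move=> finG finH wG wH [f [g fg]] [f' [g' fg']].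
have injf : injective f := mw_hom_vertex_inj finG fg fg'.
have injf' : injective f' := mw_hom_vertex_inj finH fg' fg.
have injg : injective g := mw_hom_edge_inj wG wH fg.
have injg' : injective g' := mw_hom_edge_inj wH wG fg'.
have surjg e : exists x, g x = e.
  have [x <-] :=
    finite_inj_surj (mw_finite_edge finH) (inj_comp injg injg') e.
  by exists (g' x).
have wf v : wV (f v) = wV v.
  apply/le_anti/andP; split; first exact: mw_hom_vertex_le fg injf v.
  rewrite -(finite_self_map_nonincreasing finG (inj_comp injf' injf)
    (a := fun v => wV v)) => [|u] /=.
    exact: mw_hom_vertex_le fg' injf' (f v).
  exact: mw_hom_vertex_le (mw_hom_comp fg fg') (inj_comp injf' injf) u.
(* The given [f'] and [g'] need not be inverse to [f] and [g]. *)
have [fi fK fiK] := inj_surj_cancel injf (mw_hom_vertex_surj fg).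
have [gi gK giK] := inj_surj_cancel injg surjg.
exists f, g, fi, gi; split=> //; case: fg => bdfg alfg _ _.
split=> [e|e|v|e].
- have := bdfg (gi e); rewrite giK => -> /=.
  by rewrite !fK; case: (bd (gi e)).
- by rewrite alfg giK.
- rewrite -{2}(fK v) (esum_fibre_inj (a := fun v => (wV v)%:E)) ?wV_ge0//.
    by rewrite wf.
  exact: can_inj fiK.
- rewrite -{1}(gK e) (esum_fibre_inj (a := fun e => (wE e)%:E)) ?wE_ge0//.
    by rewrite wG wH.
  exact: can_inj giK.
Qed.

(** * The order on isomorphism classes *)

Section Isoclasses.
Variable C : mwgraph A -> Prop.

Lemma isoclass_inhabited (X : isoclass C) : exists G, sval X G.
Proof.
case: X => X /= [G CG ->]; exists G; split=> //.
by case: mw_iso_equivalence => + _ _; exact.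
Qed.

Lemma isoclass_mem (X : isoclass C) G : sval X G -> C G.
Proof. by case: X => X /= [G0 _ ->] []. Qed.

Lemma isoclass_iso (X : isoclass C) G H : sval X G -> sval X H -> mw_iso G H.
Proof.
case: X => X /= [G0 _ ->] [_ iG] [_ iH].
by case: mw_iso_equivalence => _ tr sy; exact: tr (sy _ _ iG) iH.
Qed.

(** Equality of classes is equality of predicates; the proofs that these are
    classes are identified by proof irrelevance. *)
Lemma isoclass_eq (X Y : isoclass C) G H :
  sval X G -> sval Y H -> mw_iso G H -> X = Y.
Proof.
case: mw_iso_equivalence => _ tr sy.
case: X Y => [X /= pX] [Y /= pY] XG YH iGH; apply: eq_exist.
case: pX pY XG YH => [G0 _ ->] [H0 _ ->] [_ iG] [_ iH].
have i0 : mw_iso G0 H0 := tr _ _ _ (tr _ _ _ iG iGH) (sy _ _ iH).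
apply/funext => K; apply/propext; split=> -[CK iK]; split=> //.
  exact: tr (sy _ _ i0) iK.
exact: tr i0 iK.
Qed.

Lemma isoclass_le_repr (X Y : isoclass C) G H :
  sval X G -> sval Y H -> (isoclass_le X Y <-> mw_le G H).
Proof.
have [_ tr] := mw_le_preorder.
move=> XG YH; split=> [[G' [H' [XG' YH' le']]]|le]; last by exists G, H.
apply: (tr _ G'); first exact/mw_iso_le/(isoclass_iso XG XG').
by apply: (tr _ H') => //; exact/mw_iso_le/(isoclass_iso YH' YH).
Qed.

Lemma mw_le_order_on_isoclasses_of_antisym :
  (forall G H, C G -> C H -> mw_le G H -> mw_le H G -> mw_iso G H) ->
  mw_le_order_on_isoclasses C.
Proof.
move=> anti; have [re tr] := mw_le_preorder.
split; [exact: mw_iso_equivalence|exact: isoclass_le_repr|].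
split=> [X|X Y Z|X Y].
- by have [G XG] := isoclass_inhabited X; exists G, G.
- have [G XG] := isoclass_inhabited X; have [H YH] := isoclass_inhabited Y.
  have [K ZK] := isoclass_inhabited Z.
  move=> /(isoclass_le_repr XG YH) GH /(isoclass_le_repr YH ZK) HK.
  by apply/(isoclass_le_repr XG ZK); exact: tr GH HK.
- have [G XG] := isoclass_inhabited X; have [H YH] := isoclass_inhabited Y.
  move=> /(isoclass_le_repr XG YH) GH /(isoclass_le_repr YH XG) HG.
  apply: (isoclass_eq XG YH); apply: anti => //.
    exact: isoclass_mem XG.
  exact: isoclass_mem YH.
Qed.

End Isoclasses.

Lemma constant_edge_weight_order C (c : R) :
  (forall G, C G -> mw_finite G /\ (forall e : edge G, wE e = c)) ->
  mw_le_order_on_isoclasses C.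
Proof.
move=> Cc; apply: mw_le_order_on_isoclasses_of_antisym => G H.
by move=> /Cc[finG wG] /Cc[finH wH]; exact: mw_le_antisym wG wH.
Qed.

End MWOrder.

Theorem proposition2p21 (R : realType) (A : zmodClosed (angle R)) :
  preorder (mwgraph A) mw_le /\
  [/\ mw_le_order_on_isoclasses
        (fun G : mwgraph A => mw_finite G /\ standard_weights G),
      mw_le_order_on_isoclasses
        (fun G : mwgraph A => mw_finite G /\ combinatorial_weights G)
    & forall (C : mwgraph A -> Prop) (c : R),
        (forall G : mwgraph A, C G ->
           mw_finite G /\ (forall e : edge G, wE e = c)) ->
        mw_le_order_on_isoclasses C].
Proof.
split; first exact: mw_le_preorder.
split; last exact: constant_edge_weight_order.
- by apply: (@constant_edge_weight_order _ _ _ 1) => G [? []].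
- by apply: (@constant_edge_weight_order _ _ _ 1) => G [? []].
Qed.
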